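(* There is an $\varepsilon>0$ such that $e(\ell_p^{56})\ge 58$ for every real $p$ with $|p-5|<\varepsilon$. In particular, if $p_0=\inf\{p>2 : e(\ell_p^n)>n+1 \text{ for some } n\in\mathbb{N}\}$, where $p$ ranges over finite real numbers, then $p_0\in[4,5)$.
   Context: For $1\le p<\infty$, $\ell_p^n$ denotes $\mathbb{R}^n$ with the norm $\lVert x\rVert_p=\left(\sum_{r=1}^n |x_r|^p\right)^{1/p}$. A set of points in a normed space is equilateral if the distance between every two distinct points of the set is the same. For a finite-dimensional normed space $X$, $e(X)$ denotes the largest size of an equilateral set in $X$. $\mathbb{N}$ denotes the positive integers. *)

(* Defs.v *)
From HB Require Import structures.
From mathcomp Require Import all_boot all_order all_algebra finmap.
From mathcomp Require Import classical_sets reals exp.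

Set Implicit Arguments.
Unset Strict Implicit.
Unset Printing Implicit Defensive.

Import Order.TTheory GRing.Theory Num.Theory.
Local Open Scope classical_set_scope.
Local Open Scope ring_scope.

(* A norm only for 1 <= p; the formula is total in p. *)
Definition lp_norm (R : realType) (n : nat) (p : R) (x : 'rV[R]_n) : R :=
  (\sum_(r < n) `|x 0 r| `^ p) `^ p^-1.

Definition equilateral (R : realType) (V : lmodType R) (N : V -> R)
    (S : set V) : Prop :=
  exists d : R, forall x y : V, S x -> S y -> x <> y -> N (x - y) = d.

Definition equilateral_sizes (R : realType) (V : lmodType R) (N : V -> R) :
    set nat :=
  [set k | exists2 S : {fset V}, equilateral N [set` S] & #|` S|%fset = k].

(* The greatest element of [equilateral_sizes N].  One exists for every norm
   on a finite-dimensional space; without one the value would be 0. *)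
Definition equilateral_number (R : realType) (V : lmodType R) (N : V -> R) :
    nat :=
  xget 0%N (equilateral_sizes N `&` ubound (equilateral_sizes N)).

Definition e_lp (R : realType) (p : R) (n : nat) : nat :=
  equilateral_number (@lp_norm R n p).

(* Main.v *)
Require Import Defs.
From HB Require Import structures.
From Stdlib Require Import ZArith.
From mathcomp Require Import all_boot all_order all_algebra finmap.
From mathcomp Require Import classical_sets reals exp.
From mathcomp Require Import boolp functions interval_inference topology.
From mathcomp Require Import normedtype sequences derive realfun.
From mathcomp Require Import ring lra zify ssrZ.

(* For 2 < p < 4 the kernel |s - t|^p is conditionally positive: the form
   sum_ij c_i c_j |t_i - t_j|^p is nonnegative when sum c_i = sum c_i t_i = 0.
   An equilateral set of n + 2 points in l_p^n carries coefficients c <> 0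
   satisfying these n + 1 linear conditions in every coordinate, and summing over
   the coordinates gives 0 <= - D * sum c_i^2, a contradiction.

   Near p = 5, 58 equidistant points of R^56 are sought in a family with eleven
   parameters.  With coordinates in blocks of sizes 23, 23, 5, 5, half of the
   points are
     (row of the Paley tournament on Z/23 | 0 | z0 | z1)        23 points,
     (u | w | e at one place and f elsewhere | 0)                5 points,
     (sg | ta | y0 | y1)                                         1 point,
   and the others are their images under v |-> -v composed with the exchange of
   the blocks of equal size.  The distances take only eleven values, and making
   them all equal is a square system with a nondegenerate solution at p = 5, which
   a Newton contraction, started at a decimal approximation of that solution,
   finds for every p close to 5. *)

Set Implicit Arguments.
Unset Strict Implicit.
Unset Printing Implicit Defensive.

Import Order.TTheory GRing.Theory Num.Theory.
Import numFieldNormedType.Exports.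
Local Open Scope classical_set_scope.
Local Open Scope ring_scope.

(** * The binomial series of (1 - z)^b for 1 < b < 2 *)

Section Binomial.
Variables (R : realType) (b : R).

(** The coefficient of [z^k] in [(1 - z)^b], that is, [(-1)^k] times the binomial coefficient of [b]
    over [k]. *)
Definition bincoef (k : nat) : R := \prod_(i < k) ((i%:R - b) / i.+1%:R).

Definition binpoly (n : nat) : {poly R} := \sum_(k < n.+1) bincoef k *: 'X^k.

Lemma bincoef0 : bincoef 0 = 1.
Proof. by rewrite /bincoef big_ord0. Qed.

Lemma bincoefS k : bincoef k.+1 * k.+1%:R = (k%:R - b) * bincoef k.
Proof. by rewrite /bincoef big_ord_recr /= mulrA divfK ?pnatr_eq0// mulrC. Qed.

Lemma binpolyS n : binpoly n.+1 = binpoly n + bincoef n.+1 *: 'X^(n.+1).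
Proof. by rewrite /binpoly big_ord_recr. Qed.

(** The power [(1 - z)^b] solves [(1 - z) y' + b y = 0]. For the truncated series the recurrence of
    the coefficients cancels all but one boundary term. *)
Lemma binpoly_ode n (z : R) :
  (1 - z) * (binpoly n)^`().[z] + b * (binpoly n).[z] =
  (b - n%:R) * bincoef n * z ^+ n.
Proof.
elim: n => [|n IH].
  by rewrite /binpoly big_ord1 bincoef0 scale1r expr0 derivC !hornerE; ring.
rewrite binpolyS derivD !hornerD derivZ derivXn !hornerZ hornerMn !hornerXn /=.
have -> : (z ^+ n *+ n.+1 : R) = n.+1%:R * z ^+ n by rewrite mulr_natl.
have e := congr1 (fun t => t * z ^+ n) (bincoefS n).
by rewrite /= -natr1 in e *; rewrite exprS; lra.
Qed.

Lemma horner0_binpoly n : (binpoly n).[0] = 1.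
Proof.
elim: n => [|n IH]; first by rewrite /binpoly big_ord1 bincoef0 scale1r !hornerE.
by rewrite binpolyS hornerD IH hornerZ hornerXn expr0n mulr0 addr0.
Qed.

Hypothesis b12 : 1 < b < 2.

(** Exactly two numerators, [0 - b] and [1 - b], are negative. *)
Lemma bincoef_ge0 k : 0 <= bincoef k.+2.
Proof.
have [b1 b2] := andP b12.
elim: k => [|k IH].
  rewrite /bincoef !big_ord_recl big_ord0 /= /bump /=.
  have -> : (0%:R - b) / 1%:R * ((1%:R - b) / 2%:R * 1) = b * (b - 1) / 2 by field.
  by rewrite divr_ge0// mulr_ge0//; lra.
rewrite -(@pmulr_lge0 _ k.+3%:R) ?ltr0n// bincoefS mulr_ge0//.
rewrite subr_ge0 (le_trans (ltW b2))// ler_nat; lia.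
Qed.

(* The bound propagates because |k - b| <= k - 1 for k >= 2. *)
Lemma bincoef_le2 k : bincoef k.+2 * (k.+2 * k.+1)%:R <= 2.
Proof.
have [b1 b2] := andP b12.
elim: k => [|k IH].
  rewrite /bincoef !big_ord_recl big_ord0 /= /bump /=.
  have -> : (0%:R - b) / 1%:R * ((1%:R - b) / 2%:R * 1) * (2 * 1)%:R =
    b * (b - 1) by field.
  by nra.
apply: le_trans IH; rewrite !natrM mulrA bincoefS.
have c0 := mulr_ge0 (bincoef_ge0 k) (ler0n R k.+2).
rewrite -[X in _ <= _ * (X * _)]mulr1.
have -> : (k.+2%:R - b) * bincoef k.+2 * k.+2%:R =
  bincoef k.+2 * k.+2%:R * (k.+2%:R - b) by ring.
by rewrite mulr1 [leRHS]mulrA ler_wpM2l// -natr1; lra.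
Qed.

Lemma binpoly_ode_bound n (z : R) : 0 <= z ->
  `|(b - n.+2%:R) * bincoef n.+2 * z ^+ n.+2| <= 2 * z ^+ n.+2 / n.+1%:R.
Proof.
move=> z0; have [b1 b2] := andP b12.
have n2 : 2 <= (n.+2%:R : R) by rewrite ler_nat.
rewrite -mulrA normrM [X in _ * X]ger0_norm; last first.
  by rewrite mulr_ge0 ?exprn_ge0 ?bincoef_ge0.
rewrite ler0_norm; last lra.
have := bincoef_le2 n; rewrite natrM => h.
have n1 : 0 < (n.+1%:R : R) by rewrite ltr0n.
rewrite ler_pdivlMr//.
rewrite (_ : - (b - n.+2%:R) * (bincoef n.+2 * z ^+ n.+2) * n.+1%:R =
  (n.+2%:R - b) * n.+1%:R * bincoef n.+2 * z ^+ n.+2); last ring.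
rewrite ler_wpM2r ?exprn_ge0//; apply: le_trans h.
have c0 := mulr_ge0 (bincoef_ge0 n) (ltW n1).
have -> : (n.+2%:R - b) * n.+1%:R * bincoef n.+2 =
  bincoef n.+2 * n.+1%:R * (n.+2%:R - b) by ring.
by rewrite [n.+2%:R * _]mulrC mulrA ler_wpM2l//; lra.
Qed.

(** For [z < 1], the quotient of the truncated series by [(1 - z)^b] has a derivative controlled by
    the boundary term, and the mean value theorem compares it with its value 1 at 0. A constant
    depending on [z] suffices, since only finitely many values of [z] occur later. *)
Lemma binpoly_approx (z : R) : 0 <= z <= 1 ->
  exists K : R, forall n,
    `|(binpoly n.+2).[z] - (1 - z) `^ b| <= K / n.+1%:R.
Proof.
have [b1 b2] := andP b12.
move=> /andP[z0]; rewrite le_eqVlt => /predU1P[->|z1].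
  (* At [z = 1] the derivative drops out, so [b] times the truncated series is the boundary term;
     [b > 1] absorbs the factor. *)
  exists 2 => n; rewrite subrr powR0; last lra.
  have e := binpoly_ode n.+2 1.
  rewrite subrr mul0r add0r in e.
  have := binpoly_ode_bound n (z := 1) ler01.
  rewrite -e expr1n mulr1 subr0 => h; apply: le_trans h.
  by rewrite normrM (@ger0_norm _ b) ?ler_peMl//; lra.
have [z00|z0'] := eqVneq z 0.
  exists 0 => n.
  by rewrite z00 horner0_binpoly subr0 powR1 subrr normr0 mul0r.
have zgt0 : 0 < z by rewrite lt_neqAle eq_sym z0'.
(* The first factor bounds [(1 - c)^(- b - 1)] for [c < z], 2 comes from the boundary term, and the
   last factor undoes the division. *)
exists ((1 - z) `^ (- b - 1) * 2 * (1 - z) `^ b) => n.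
pose f (x : R) : R := (binpoly n.+2).[x] * (1 - x) `^ (- b).
pose df (x : R) : R := (1 - x) `^ (- b - 1) * ((b - n.+2%:R) * bincoef n.+2 * x ^+ n.+2).
have fd (x : R) : x < 1 -> is_derive x (1 : R) f (df x).
  move=> x1.
  have d2 : is_derive (1 - x) (1 : R) (@powR R ^~ (- b)) (- b * (1 - x) `^ (- b - 1)).
    by apply: is_derive1_powR; lra.
  have d1 : is_derive x (1 : R) ((@powR R ^~ (- b)) \o (fun x => 1 - x))
     (b * (1 - x) `^ (- b - 1)).
    by apply: is_derive_eq; ring.
  have -> : f = horner (binpoly n.+2) * ((@powR R ^~ (- b)) \o (fun x => 1 - x)) by [].
  apply: is_derive_eq; rewrite /df -binpoly_ode /= /GRing.scale /=.
  have -> : (1 - x) `^ (- b) = (1 - x) * (1 - x) `^ (- b - 1).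
    rewrite -{2}(@powRr1 _ (1 - x)); last lra.
    rewrite -powRD; first by congr (_ `^ _); ring.
    by apply/implyP => _; rewrite lt0r_neq0; lra.
  ring.
have [||c] := @MVT R f df 0 z zgt0.
- by move=> x; rewrite in_itv /= => /andP[_ xz]; apply: fd; lra.
- apply: continuous_in_subspaceT => x; rewrite inE /= in_itv /= => /andP[_ xz].
  have /fd[+ _] : x < 1 by lra.
  by move/derivable1_diffP/differentiable_continuous.
rewrite in_itv /= => /andP[c0 cz]; rewrite {1}/f {1}/f.
rewrite horner0_binpoly subr0 subr0 powR1 mulr1 => e.
have p0 : 0 < (1 - z) `^ b by rewrite powR_gt0; lra.
have -> : (binpoly n.+2).[z] - (1 - z) `^ b =
   (df c * z) * (1 - z) `^ b.
  rewrite -e powRN; field; exact: lt0r_neq0.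
have n0 : 0 <= (n.+1%:R^-1 : R) by rewrite invr_ge0 ler0n.
have hc : `|df c| <= (1 - z) `^ (- b - 1) * (2 / n.+1%:R).
  rewrite normrM (ger0_norm (powR_ge0 _ _)) ler_pM ?powR_ge0//.
    rewrite -opprD !powRN lef_pV2 ?posrE ?powR_gt0; [|lra..].
    by rewrite ge0_ler_powR ?nnegrE; lra.
  apply: le_trans (binpoly_ode_bound _ (ltW c0)) _.
  by rewrite ler_wpM2r// ler_piMr// exprn_ile1 ?ltW//; lra.
rewrite normrM (@ger0_norm _ (_ `^ b)) ?powR_ge0// [leRHS]mulrAC ler_wpM2r ?powR_ge0//.
rewrite -[leRHS]mulr1 normrM ler_pM//; first by rewrite -mulrA.
by rewrite ger0_norm // ltW.
Qed.

End Binomial.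

(** * Conditional positivity of |s - t|^p for 2 < p < 4 *)

Lemma le_of_le_div (R : archiRealFieldType) (x y C : R) :
  (forall n : nat, x <= y + C / n.+1%:R) -> x <= y.
Proof.
move=> h; rewrite leNgt; apply/negP => xy.
have d0 : 0 < x - y by rewrite subr_gt0.
have := h (Num.truncn (C / (x - y))); apply/negP.
rewrite -ltNge -ltrBrDl ltr_pdivrMr ?ltr0n//.
by rewrite mulrC -ltr_pdivrMr// truncnS_gt.
Qed.

Section ConditionallyPositive.
Variables (R : realType) (k : nat).
Implicit Types (c t w : 'I_k -> R).

(** A factor [1 + t i * t j] splits the form into two of lower degree, with coefficients [c i] and
    [c i * t i]; degree 0 is a square. *)
Lemma sumM_pow_ge0 c t m :
  0 <= \sum_i \sum_j c i * c j * (1 + t i * t j) ^+ m.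
Proof.
elim: m c => [|m IH] c.
  under eq_bigr => i _ do under eq_bigr => j _ do rewrite expr0 mulr1.
  under eq_bigr => i _ do rewrite -mulr_sumr.
  by rewrite -mulr_suml -expr2 sqr_ge0.
have := addr_ge0 (IH c) (IH (fun i => c i * t i)).
rewrite -big_split /=; under eq_bigr => i _ do rewrite -big_split /=.
move/le_trans; apply; rewrite le_eqVlt; apply/orP; left; apply/eqP.
by apply: eq_bigr => i _; apply: eq_bigr => j _; rewrite exprS; ring.
Qed.

Variable b : R.
Hypothesis b12 : 1 < b < 2.

Let A t i : R := 1 + t i ^+ 2.
(** The squared cosine of the angle between the vectors [(1, t i)] and [(1, t j)]. *)
Let z t i j : R := (1 + t i * t j) ^+ 2 / (A t i * A t j).

Let A_ge1 t i : 1 <= A t i. Proof. by rewrite lerDl sqr_ge0. Qed.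
Let A_gt0 t i : 0 < A t i. Proof. exact: lt_le_trans ltr01 (A_ge1 _ _). Qed.

(* Lagrange's identity. *)
Let onemz t i j : 1 - z t i j = (t i - t j) ^+ 2 / (A t i * A t j).
Proof.
rewrite /z -{1}(@divff _ (A t i * A t j)) ?gt_eqF ?mulr_gt0//.
by rewrite -mulrBl; congr (_ / _); rewrite /A; ring.
Qed.

Let z01 t i j : 0 <= z t i j <= 1.
Proof.
have AA : 0 < A t i * A t j by rewrite mulr_gt0.
rewrite divr_ge0 ?sqr_ge0 ?(ltW AA)//= -subr_ge0 onemz.
by rewrite divr_ge0 ?sqr_ge0 ?(ltW AA).
Qed.

Let sumz_ge0 w t m : 0 <= \sum_i \sum_j w i * w j * z t i j ^+ m.
Proof.
have := sumM_pow_ge0 (fun i => w i / A t i ^+ m) t (2 * m).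
move/le_trans; apply; rewrite le_eqVlt; apply/orP; left; apply/eqP.
apply: eq_bigr => i _; apply: eq_bigr => j _.
by rewrite /z exprM expr_div_n (exprMn _ (A t i)) invfM; ring.
Qed.

(** Each power of [z] gives a nonnegative form, and only the coefficient [- b] of degree 1 is
    negative. *)
Let sum_binpoly_ge w t n :
  - b * \sum_i \sum_j w i * w j * z t i j <=
  \sum_i \sum_j w i * w j * (binpoly b n.+2).[z t i j].
Proof.
under [leRHS]eq_bigr => i _ do under eq_bigr => j _ do
  rewrite /binpoly horner_sum mulr_sumr.
under [leRHS]eq_bigr => i _ do rewrite exchange_big.
rewrite [leRHS]exchange_big /=.
have -> : \sum_(m < n.+3) \sum_i \sum_j w i * w j * (bincoef b m *: 'X^m).[z t i j] =
  \sum_(m < n.+3) bincoef b m * \sum_i \sum_j w i * w j * z t i j ^+ m.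
  apply: eq_bigr => m _; rewrite mulr_sumr; apply: eq_bigr => i _.
  rewrite mulr_sumr; apply: eq_bigr => j _; rewrite hornerZ hornerXn; ring.
rewrite 2!big_ord_recl /= !bincoef0 mul1r.
have -> : bincoef b (bump 0 0) = - b.
  by rewrite /bincoef big_ord1 /= divr1 sub0r.
have e : \sum_i \sum_j w i * w j * z t i j ^+ (bump 0 0) =
    \sum_i \sum_j w i * w j * z t i j.
  by apply: eq_bigr => i _; apply: eq_bigr => j _; rewrite expr1.
rewrite e addrCA lerDl addr_ge0 ?sumz_ge0// sumr_ge0// => m _.
by rewrite mulr_ge0 ?sumz_ge0 ?bincoef_ge0.
Qed.

(** Since [(t i - t j)^2 = A t i * A t j * (1 - z t i j)], the kernel is a weighted [(1 - z)^b]. Its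
    truncated series is bounded below by the linear term, and the truncation error tends to 0. *)
Lemma sum_powR_dist_ge c t :
  - b * \sum_i \sum_j (c i * (1 + t i ^+ 2) `^ (b - 1)) *
     (c j * (1 + t j ^+ 2) `^ (b - 1)) * (1 + t i * t j) ^+ 2 <=
  \sum_i \sum_j c i * c j * `|t i - t j| `^ (2 * b).
Proof.
have [b1 b2] := andP b12.
pose w i := c i * A t i `^ b.
have -> : \sum_i \sum_j c i * c j * `|t i - t j| `^ (2 * b) =
    \sum_i \sum_j w i * w j * (1 - z t i j) `^ b.
  apply: eq_bigr => i _; apply: eq_bigr => j _.
  rewrite onemz powRrM powR_mulrn ?normr_ge0// real_normK ?num_real//.
  rewrite (@powRM _ (_ ^+ 2)) ?sqr_ge0 ?invr_ge0 ?mulr_ge0 ?(ltW (A_gt0 _ _))//.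
  rewrite -[(_ * _)^-1]powR_inv1 ?mulr_ge0 ?(ltW (A_gt0 _ _))// powRAC.
  rewrite powR_inv1 ?powR_ge0// (@powRM _ (A t i)) ?(ltW (A_gt0 _ _))// /w.
  by field; rewrite !gt_eqF ?powR_gt0.
have -> : \sum_i \sum_j (c i * (1 + t i ^+ 2) `^ (b - 1)) *
     (c j * (1 + t j ^+ 2) `^ (b - 1)) * (1 + t i * t j) ^+ 2 =
    \sum_i \sum_j w i * w j * z t i j.
  apply: eq_bigr => i _; apply: eq_bigr => j _; rewrite /w /z.
  rewrite -![A t _ `^ b](@mulr_powRB1 R) ?(ltW (A_gt0 _ _))//; [|lra..].
  by rewrite -!/(A t _); field; rewrite !gt_eqF.
have /choice[K HK] (ij : 'I_k * 'I_k) : exists K : R, forall n,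
    `|(binpoly b n.+2).[z t ij.1 ij.2] - (1 - z t ij.1 ij.2) `^ b| <= K / n.+1%:R.
  by have [K HK] := binpoly_approx b12 (z01 t ij.1 ij.2); exists K.
apply: (@le_of_le_div _ _ _ (\sum_i \sum_j `|w i * w j| * K (i, j))) => n.
apply: le_trans (sum_binpoly_ge w t n) _.
rewrite mulr_suml -big_split; apply: ler_sum => i _ /=.
rewrite mulr_suml -big_split; apply: ler_sum => j _ /=.
rewrite -lerBlDl -mulrBr; apply: le_trans (ler_norm _) _.
by rewrite (normrM (w i * w j)) -[leRHS]mulrA ler_wpM2l ?normr_ge0// (HK (i, j)).
Qed.
End ConditionallyPositive.

(** Replacing [t] by [u * t] multiplies the form by [u^p], while the two linear conditions make the
    lower bound of order [u^4]. As [p < 4], letting [u] tend to 0 gives the claim. *)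
Lemma sum_powR_dist_ge0 (R : realType) (k : nat) (p : R) (c t : 'I_k -> R) :
  2 < p < 4 -> \sum_i c i = 0 -> \sum_i c i * t i = 0 ->
  0 <= \sum_i \sum_j c i * c j * `|t i - t j| `^ p.
Proof.
move=> /andP[p2 p4] c0 ct0; set Q := (X in 0 <= X).
pose b := p / 2; have b12 : 1 < b < 2 by rewrite /b; lra.
have [b1 b2] := andP b12.
(* The fourth power dominates [t^2], [|t|^3] and [(1 + t^2) t^2], which occur in the three moments
   below. *)
pose M := \sum_i `|c i| * (1 + `|t i|) ^+ 4.
suff H (u : R) : 0 < u <= 1 -> 0 <= Q + 4 * b * M ^+ 2 * u `^ (4 - p).
  apply: (@le_of_le_div _ _ _ (4 * b * M ^+ 2)) => n.
  have n0 : 0 < (n.+1%:R : R) by rewrite ltr0n.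
  (* The choice of [u] is [(n + 1)^(-1 / (4 - p))], which makes [u^(4 - p)] equal to
     [1 / (n + 1)]. *)
  have <- : (n.+1%:R^-1 `^ (4 - p)^-1) `^ (4 - p) = n.+1%:R^-1.
    by rewrite -powRrM mulVf ?powRr1 ?invr_ge0 ?(ltW n0)//; lra.
  apply: H.
  rewrite powR_gt0 ?invr_gt0//= -[leRHS](congr1 (fun f => f (4 - p)^-1) (powR1 R)).
  rewrite ge0_ler_powR ?nnegrE ?invr_ge0 ?ler0n ?invf_le1 ?ler1n//; lra.
move=> /andP[u0 u1].
have := sum_powR_dist_ge b12 c (fun i => u * t i).
have -> : 2 * b = p by rewrite /b; field.
have -> : \sum_i \sum_j c i * c j * `|u * t i - u * t j| `^ p = u `^ p * Q.
  rewrite mulr_sumr; apply: eq_bigr => i _; rewrite mulr_sumr; apply: eq_bigr => j _.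
  by rewrite -mulrBr normrM powRM// (gtr0_norm u0); ring.
pose B i : R := (1 + (u * t i) ^+ 2) `^ (b - 1).
pose S m := \sum_i c i * B i * (u * t i) ^+ m.
(* Expanding [(1 + x y)^2 = 1 + 2 x y + x^2 y^2] separates the double sum into squares of
   moments. *)
rewrite (_ : \sum_i \sum_j _ = S 0%N ^+ 2 + 2 * S 1%N ^+ 2 + S 2%N ^+ 2); last first.
  have sq (f : 'I_k -> R) : (\sum_i f i) ^+ 2 = \sum_i \sum_j f i * f j.
    by rewrite expr2 mulr_suml; apply: eq_bigr => i _; rewrite mulr_sumr.
  rewrite !sq mulr_sumr -!big_split; apply: eq_bigr => i _ /=.
  rewrite mulr_sumr -!big_split; apply: eq_bigr => j _ /=.
  rewrite -!/(B _) expr0 expr1; ring.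
have B1 i : 0 <= B i - 1 <= (u * t i) ^+ 2.
  have A1 : 1 <= 1 + (u * t i) ^+ 2 by rewrite lerDl sqr_ge0.
  rewrite subr_ge0 -{1}(powRr0 (1 + (u * t i) ^+ 2)) ler_powR//=; last lra.
  by rewrite lerBlDl ler1_powR//; lra.
have T0 i : 0 <= `|t i| by exact: normr_ge0.
have S0 : `|S 0%N| <= u ^+ 2 * M.
  (* The condition on [c] allows [B i] to be replaced by [B i - 1], which is of order [u^2]; the
     second condition does the same for [S 1], and [S 2] has the factor [u^2] already. *)
  have -> : S 0%N = \sum_i c i * (B i - 1).
    by rewrite /S -[LHS]subr0 -{2}c0 -sumrB; apply: eq_bigr => i _; ring.
  apply: le_trans (ler_norm_sum _ _ _) _; rewrite mulr_sumr; apply: ler_sum => i _.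
  rewrite normrM mulrCA ler_wpM2l//; have /andP[B0 Bu] := B1 i.
  rewrite ger0_norm//; apply: le_trans Bu _.
  rewrite exprMn ler_wpM2l ?sqr_ge0// -(real_normK (num_real (t i))).
  by have := T0 i; set x := `|t i|; move=> x0; nra.
have S1 : `|S 1%N| <= u ^+ 2 * M.
  have -> : S 1%N = \sum_i c i * (B i - 1) * (u * t i).
    have e : u * \sum_i c i * t i = 0 by rewrite ct0 mulr0.
    rewrite /S -[LHS]subr0 -{2}e mulr_sumr -sumrB.
    by apply: eq_bigr => i _; ring.
  apply: le_trans (ler_norm_sum _ _ _) _; rewrite mulr_sumr; apply: ler_sum => i _.
  rewrite -[c i * _ * _]mulrA normrM [leRHS]mulrCA ler_wpM2l// normrM.
  have /andP[B0 Bu] := B1 i.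
  rewrite (ger0_norm B0); apply: (@le_trans _ _ ((u * t i) ^+ 2 * `|t i|)).
    by rewrite ler_pM// normrM ler_piMl// gtr0_norm.
  rewrite (exprMn _ u) -[leLHS]mulrA ler_wpM2l ?sqr_ge0// -(real_normK (num_real (t i))).
  by have := T0 i; set x := `|t i|; move=> x0; nra.
have S2 : `|S 2%N| <= u ^+ 2 * M.
  apply: le_trans (ler_norm_sum _ _ _) _; rewrite mulr_sumr; apply: ler_sum => i _.
  rewrite -[c i * _ * _]mulrA normrM [leRHS]mulrCA ler_wpM2l// normrM.
  have /andP[B0 Bu] := B1 i.
  rewrite ger0_norm; last lra.
  rewrite (ger0_norm (sqr_ge0 _)) (exprMn _ u) mulrCA ler_wpM2l ?sqr_ge0//.
  apply: (@le_trans _ _ ((1 + t i ^+ 2) * t i ^+ 2)).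
    rewrite ler_wpM2r ?sqr_ge0//; have : (u * t i) ^+ 2 <= t i ^+ 2; last lra.
    by rewrite (exprMn _ u) ler_piMl ?sqr_ge0// exprn_ile1// ltW.
  rewrite -(real_normK (num_real (t i))).
  by have := T0 i; set x := `|t i|; move=> x0; nra.
have HS m : `|S m| <= u ^+ 2 * M -> S m ^+ 2 <= u ^+ 4 * M ^+ 2.
  move=> h; rewrite -real_normK ?num_real//.
  rewrite (_ : u ^+ 4 * M ^+ 2 = (u ^+ 2 * M) ^+ 2); last ring.
  by rewrite lerXn2r ?nnegrE//; exact: le_trans h.
have h0 := HS _ S0; have h1 := HS _ S1; have h2 := HS _ S2 => h.
have up : 0 < u `^ p by rewrite powR_gt0.
rewrite -(pmulr_rge0 _ up) mulrDr.
have -> : u `^ p * (4 * b * M ^+ 2 * u `^ (4 - p)) = 4 * b * (u ^+ 4 * M ^+ 2).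
  rewrite -(powR_mulrn 4 (ltW u0)).
  have -> : u `^ 4%:R = u `^ p * u `^ (4 - p).
    rewrite -powRD; last by apply/implyP => _; rewrite gt_eqF.
    by rewrite addrC subrK.
  ring.
nra.
Qed.

(** * Sizes of equilateral sets *)

Section Sizes.
Variables (R : realType) (n : nat) (p : R).

Lemma lp_norm_eqP (x : 'rV[R]_n) d : p != 0 -> lp_norm p x = d ->
  \sum_(r < n) `|x 0 r| `^ p = d `^ p.
Proof.
move=> p0 <-; rewrite /lp_norm -powRrM mulVf// powRr1//.
by apply: sumr_ge0 => r _; rewrite powR_ge0.
Qed.

Lemma equilateral_sizeP k : p != 0 -> equilateral_sizes (@lp_norm R n p) k ->
  exists2 x : 'I_k -> 'rV[R]_n, injective x & exists2 D : R, 0 <= D &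
    forall i j, i != j -> \sum_(r < n) `|x i 0 r - x j 0 r| `^ p = D.
Proof.
move=> p0 [S [d Sd] Sk]; have szS : size (enum_fset S) = k by rewrite -Sk.
have xS (i : 'I_k) : nth 0 (enum_fset S) i \in S by rewrite mem_nth ?szS.
have xI : injective (fun i : 'I_k => nth 0 (enum_fset S) i).
  move=> i j /eqP; rewrite nth_uniq ?szS ?fset_uniq// => /eqP; exact: val_inj.
exists (fun i : 'I_k => nth 0 (enum_fset S) i) => //.
exists (d `^ p) => [|i j ij]; first exact: powR_ge0.
rewrite -(@lp_norm_eqP (nth 0 (enum_fset S) i - nth 0 (enum_fset S) j) d)//.
  by apply: eq_bigr => r _; rewrite !mxE.
by apply: Sd; [exact: xS|exact: xS|move/xI/eqP; rewrite (negbTE ij)].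
Qed.

Lemma size_lt_e_lp k : (k < e_lp p n)%N -> exists2 m,
  (k < m)%N & equilateral_sizes (@lp_norm R n p) m.
Proof.
(* The default value 0 of [xget] cannot exceed [k]. *)
rewrite /e_lp /equilateral_number; case: xgetP => // m _ [Am _] km.
by exists m.
Qed.

Lemma sum_powR_gt0 (x y : 'rV[R]_n) : x != y ->
  0 < \sum_(r < n) `|x 0 r - y 0 r| `^ p.
Proof.
move=> xy; have [r xyr] : exists r, x 0 r != y 0 r.
  apply/existsP; apply: contraR xy; rewrite negb_exists => /forallP h.
  by apply/eqP/rowP => r; apply/eqP; have := h r; rewrite negbK.
rewrite (bigD1 r)//= ltr_pwDl ?powR_gt0 ?normr_gt0 ?subr_eq0//.
by apply: sumr_ge0 => s _; rewrite powR_ge0.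
Qed.

End Sizes.

Lemma equilateral_size_le_succ (R : realType) (n : nat) (p : R) k :
  2 < p < 4 -> equilateral_sizes (@lp_norm R n p) k -> (k <= n.+1)%N.
Proof.
move=> p24; have p0 : p != 0 by rewrite gt_eqF//; case/andP: p24; lra.
case/(equilateral_sizeP p0) => x xI [D D0 xD]; rewrite leqNgt; apply/negP => nk.
(* The rows are [(1, x i)]. More than [n + 1] of them are linearly dependent, and a dependence is a
   vector [c] meeting all the conditions. *)
pose X : 'M[R]_(k, 1 + n) := row_mx (const_mx 1) (\matrix_(i, r) x i 0 r).
have /rowV0Pn[c /sub_kermxP cX c0] : kermx X != 0.
  rewrite kermx_eq0 -row_leq_rank -ltnNge.
  exact: leq_ltn_trans (rank_leq_col _) nk.
move: cX; rewrite mul_mx_row -[RHS](row_mx0 _ _) => /eq_row_mx[c1 cx].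
have sc : \sum_i c 0 i = 0.
  transitivity ((c *m const_mx 1 : 'rV[R]_1) 0 0); last by rewrite c1 mxE.
  by rewrite mxE; apply: eq_bigr => i _; rewrite mxE mulr1.
have scx r : \sum_i c 0 i * x i 0 r = 0.
  transitivity ((c *m (\matrix_(i, r) x i 0 r)) 0 r); last by rewrite cx mxE.
  by rewrite mxE; apply: eq_bigr => i _; rewrite mxE.
have h : 0 <= \sum_(r < n) \sum_i \sum_j c 0 i * c 0 j * `|x i 0 r - x j 0 r| `^ p.
  by apply: sumr_ge0 => r _; apply: sum_powR_dist_ge0.
have e : \sum_(r < n) \sum_i \sum_j c 0 i * c 0 j * `|x i 0 r - x j 0 r| `^ p
   = - D * \sum_i c 0 i ^+ 2.
  rewrite exchange_big mulr_sumr; apply: eq_bigr => i _.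
  (* For fixed [i] the diagonal term is 0 and the other [c j] sum to [- c i], leaving
     [- D * c i ^ 2]. *)
  rewrite exchange_big (bigD1 i)//= big1 ?add0r => [|r _]; last first.
    by rewrite subrr normr0 powR0 ?mulr0.
  under eq_bigr => j ji do rewrite -mulr_sumr xD 1?eq_sym//.
  have := sc; rewrite (bigD1 i)//= => /eqP; rewrite addrC addr_eq0 => /eqP si.
  by rewrite -mulr_suml -mulr_sumr si; ring.
have [i ci] : exists i, c 0 i != 0.
  apply/existsP; apply: contraR c0; rewrite negb_exists => /forallP h0.
  by apply/eqP/rowP => i; apply/eqP; rewrite mxE; have := h0 i; rewrite negbK.
have k1 : (1 < k)%N by exact: leq_ltn_trans nk.
have D1 : 0 < D.
  have ij : Ordinal (ltnW k1) != Ordinal k1 by [].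
  by rewrite -(xD _ _ ij) sum_powR_gt0// (inj_eq xI).
have : 0 < D * \sum_i c 0 i ^+ 2.
  rewrite mulr_gt0// (bigD1 i)//= ltr_pwDl ?exprn_even_gt0//.
  by apply: sumr_ge0 => j _; rewrite sqr_ge0.
by move: h; rewrite e mulNr oppr_ge0 => /le_lt_trans h /h; rewrite ltxx.
Qed.

Lemma truncn_eq_dist_lt1 (R : archiRealDomainType) (a b : R) :
  0 <= a -> 0 <= b -> Num.truncn a = Num.truncn b -> `|a - b| < 1.
Proof.
move=> a0 b0 ab.
have /andP[a1 a2] := truncn_itv a0; have /andP[b1 b2] := truncn_itv b0.
rewrite ab in a1 a2; rewrite -natr1 in a2 b2.
by rewrite ltr_distl; apply/andP; split; lra.
Qed.

(* Two points of an equilateral set cannot share a cell of a grid whose cells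
   have a diameter smaller than the common distance. *)
Lemma equilateral_size_bounded (R : realType) (n : nat) (p : R) : 1 <= p ->
  exists B : nat, forall k, equilateral_sizes (@lp_norm R n p) k -> (k <= B)%N.
Proof.
move=> p1; have p0 : 0 < p by lra.
(* Cells have side [d / N], and [p >= 1] bounds the [p]-th power of a side by [D / N]. With
   [N = n + 1] the [n] coordinates add up to less than [D]. *)
pose N := n.+1; exists #|{ffun 'I_n -> 'I_(N.*2).+1}| => k.
case/(equilateral_sizeP (lt0r_neq0 p0)) => x xI [D D0 xD].
have [k1|k1] := leqP k 1.
  by apply: leq_trans k1 _; apply/card_gt0P; exists [ffun => ord0].
pose i0 := Ordinal (ltnW k1).
have D1 : 0 < D.
  have ij : i0 != Ordinal k1 by [].
  by rewrite -(xD _ _ ij) sum_powR_gt0// (inj_eq xI).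
pose d := D `^ p^-1.
have d0 : 0 < d by rewrite powR_gt0.
have dp : d `^ p = D by rewrite /d -powRrM mulVf ?lt0r_neq0// powRr1.
have xd i r : `|x i 0 r - x i0 0 r| <= d.
  have [->|ii0] := eqVneq i i0; first by rewrite subrr normr0 ltW.
  rewrite leNgt; apply/negP => h.
  have : d `^ p < `|x i 0 r - x i0 0 r| `^ p.
    by rewrite gt0_ltr_powR ?nnegrE ?(ltW d0).
  rewrite dp -(xD _ _ ii0) (bigD1 r)//=.
  by rewrite ltNge lerDl sumr_ge0// => s _; rewrite powR_ge0.
have N0 : 0 < (N%:R : R) by rewrite ltr0n.
pose y i r := (x i 0 r - x i0 0 r + d) * (N%:R / d).
have Nd : 0 < N%:R / d by rewrite divr_gt0.
have y0 i r : 0 <= y i r.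
  rewrite mulr_ge0 ?(ltW Nd)//; have := xd i r; rewrite ler_norml; lra.
have yN i r : (Num.truncn (y i r) <= N.*2)%N.
  have /andP[h _] := truncn_itv (y0 i r).
  rewrite -(ler_nat R); apply: le_trans h _.
  rewrite /y mulrA ler_pdivrMr// -muln2 natrM.
  have : x i 0 r - x i0 0 r + d <= 2 * d.
    by have := xd i r; rewrite ler_norml => /andP[_]; lra.
  by move/(ler_wpM2r (ltW N0)); lra.
pose f i := [ffun r => inord (Num.truncn (y i r)) : 'I_(N.*2).+1].
have fI : injective f.
  move=> i j fij; apply/eqP; apply: contraT => ij.
  have h r : `|x i 0 r - x j 0 r| <= d / N%:R.
    have /ffunP/(_ r) := fij; rewrite !ffunE => /(congr1 val) /=.
    rewrite !inordK ?ltnS// => /(truncn_eq_dist_lt1 (y0 i r) (y0 j r)).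
    have -> : y i r - y j r = (x i 0 r - x j 0 r) * (N%:R / d) by rewrite /y; ring.
    rewrite normrM (gtr0_norm Nd) => /ltW.
    by rewrite mulrA ler_pdivrMr// mul1r ler_pdivlMr.
  have : D < D; last by rewrite ltxx.
  rewrite -{1}(xD _ _ ij).
  apply: (@le_lt_trans _ _ (\sum_(r < n) D / N%:R)).
    apply: ler_sum => r _; apply: (@le_trans _ _ ((d / N%:R) `^ p)).
      by rewrite ge0_ler_powR ?nnegrE ?(ltW p0) ?divr_ge0 ?(ltW d0) ?ler0n.
    rewrite powRM ?invr_ge0 ?ler0n ?(ltW d0)// dp ler_wpM2l//.
    by apply: ge1r_powR => //; rewrite invr_gt0 N0 invf_le1 ?ler1n.
  rewrite sumr_const card_ord -[ltLHS]mulr_natr mulrAC ltr_pdivrMr// ltr_pM2l//.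
  by rewrite ltr_nat.
by have := leq_card f fI; rewrite card_ord.
Qed.

(** Sizes are bounded, so a greatest one exists and [xget] does not fall back on 0. *)
Lemma le_e_lp (R : realType) (n : nat) (p : R) k : 1 <= p ->
  equilateral_sizes (@lp_norm R n p) k -> (k <= e_lp p n)%N.
Proof.
move=> p1 Ak; have [B HB] := equilateral_size_bounded n p1.
rewrite /e_lp /equilateral_number; case: xgetP => [m _ [_ /(_ _ Ak)]|] //.
move=> no; exfalso.
have exk : exists k, `[< equilateral_sizes (@lp_norm R n p) k >].
  by exists k; exact/asboolP.
have ubk j : `[< equilateral_sizes (@lp_norm R n p) j >] -> (j <= B)%N.
  by move/asboolP/HB.
have [m /asboolP Am mmax] := ex_maxnP exk ubk.
by apply: (no m); split => // j Aj; apply: mmax; exact/asboolP.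
Qed.

(** * Linear approximation of |u|^p near p = 5 *)

Section Tangent.
Variable R : realType.
Implicit Types (p a b t u v g : R).

(** Young's inequality for [a] and [b^(p - 1)] with the conjugate exponents [p] and
    [p / (p - 1)]. *)
Lemma powR_tangent p a b : 1 < p -> 0 <= a -> 0 <= b ->
  b `^ p + p * b `^ (p - 1) * (a - b) <= a `^ p.
Proof.
move=> p1 a0 b0; have p0 : 0 < p by lra.
have q0 : 0 < p / (p - 1) by rewrite divr_gt0; lra.
have pq : p^-1 + (p / (p - 1))^-1 = 1 by field; rewrite !lt0r_neq0//; lra.
have := conjugate_powR a0 (powR_ge0 b (p - 1)) p0 q0 pq.
rewrite -powRrM.
have -> : (p - 1) * (p / (p - 1)) = p by field; rewrite lt0r_neq0//; lra.
move/(ler_wpM2l (ltW p0)).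
have -> : p * (a `^ p / p + b `^ p / (p / (p - 1))) = a `^ p + (p - 1) * b `^ p.
  by field; rewrite !lt0r_neq0//; lra.
have := mulr_powRB1 b0 p0; set B := b `^ (p - 1) => <-; lra.
Qed.

(** The derivative of [|v|^p]. *)
Definition powR_slope p v : R := p * `|v| `^ (p - 1) * Num.sg v.

Lemma normr_powR_tangent p u v : 1 < p ->
  `|v| `^ p + powR_slope p v * (u - v) <= `|u| `^ p.
Proof.
move=> p1; apply: le_trans (powR_tangent p1 (normr_ge0 u) (normr_ge0 v)).
rewrite lerD2l /powR_slope -[leLHS]mulrA ler_wpM2l ?mulr_ge0 ?powR_ge0//; first lra.
rewrite mulrBr -normrEsg lerD2r; apply: le_trans (ler_norm _) _.
by rewrite normrM normr_sg ler_piMl// lern1 leq_b1.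
Qed.

(** By convexity the tangents at [v] and at [u] enclose the increment between the two slopes times
    [u - v]. *)
Lemma normr_powR_linear_approx p u v g K : 1 < p ->
  `|powR_slope p u - g| <= K -> `|powR_slope p v - g| <= K ->
  `| `|u| `^ p - `|v| `^ p - g * (u - v)| <= K * `|u - v|.
Proof.
move=> p1 uK vK.
have h1 := normr_powR_tangent u v p1; have h2 := normr_powR_tangent v u p1.
have a1 : `|(powR_slope p u - g) * (u - v)| <= K * `|u - v|.
  by rewrite normrM ler_wpM2r.
have a2 : `|(powR_slope p v - g) * (u - v)| <= K * `|u - v|.
  by rewrite normrM ler_wpM2r.
move: a1 a2; rewrite !ler_norml => /andP[_ a1] /andP[a2 _].
apply/andP; split; lra.
Qed.

Lemma ln_le_subr1 t : 0 < t -> ln t <= t - 1.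
Proof.
by move=> t0; have := expR_ge1Dx (ln t); rewrite lnK ?posrE//; lra.
Qed.

(** For [t >= 1], [t^a <= 2^6] and [ln t <= 1]; for [t < 1], [- ln t <= 1 / t] and [t^a <= t]. *)
Lemma powR_ln_le t a : 0 < t <= 2 -> 1 <= a <= 6 -> t `^ a * `|ln t| <= 64.
Proof.
move=> /andP[t0 t2] /andP[a1 a6].
have [t1|t1] := leP 1 t.
  rewrite ger0_norm ?ln_ge0// -[64]mulr1 ler_pM ?powR_ge0 ?ln_ge0//.
    apply: (@le_trans _ _ (t `^ 6%:R)); first exact: ler_powR.
    rewrite powR_mulrn ?(ltW t0)//; apply: (@le_trans _ _ (2 ^+ 6)).
      by rewrite lerXn2r ?nnegrE ?(ltW t0).
    by rewrite -natrX.
  by apply: le_trans (ln_le_subr1 t0) _; lra.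
rewrite ler0_norm ?ln_le0 ?(ltW t1)//.
have h : - ln t <= t^-1.
  rewrite -lnV ?posrE//; apply: le_trans (ln_le_subr1 _) _; last lra.
  by rewrite invr_gt0.
apply: (@le_trans _ _ (t `^ a * t^-1)); first by rewrite ler_wpM2l ?powR_ge0.
apply: (@le_trans _ _ (t * t^-1)); last by rewrite divff ?gt_eqF//; lra.
by rewrite ler_wpM2r ?invr_ge0 ?(ltW t0)// ge1r_powR// t0 ltW.
Qed.

(** The inequality [1 + x <= expR x], applied to the ratio of the two powers, bounds the difference
    on one side; exchanging the exponents bounds it on the other. *)
Lemma powR_exponent_lipschitz t a b : 0 <= t <= 2 -> 1 <= a <= 6 -> 1 <= b <= 6 ->
  `|t `^ a - t `^ b| <= 64 * `|a - b|.
Proof.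
move=> /andP[]; rewrite le_eqVlt => /predU1P[<- _ a16 b16|t0 t2].
  by rewrite !powR0 ?subrr ?normr0 ?mulr_ge0//; lra.
have H c d : 1 <= c <= 6 -> t `^ c - t `^ d <= 64 * `|c - d|.
  move=> c16; have e : t `^ d = t `^ c * expR ((d - c) * ln t).
    by rewrite {2}/powR !gt_eqF// -expRD /powR gt_eqF//; congr expR; ring.
  apply: (@le_trans _ _ (t `^ c * ((c - d) * ln t))).
    rewrite e -{1}[t `^ c]mulr1 -mulrBr ler_wpM2l ?powR_ge0//.
    by have := expR_ge1Dx ((d - c) * ln t); lra.
  rewrite mulrCA mulrC; apply: le_trans (ler_norm _) _; rewrite !normrM.
  rewrite ler_wpM2r// (ger0_norm (powR_ge0 _ _)).
  by apply: powR_ln_le; rewrite ?t0.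
move=> a16 b16; rewrite ler_norml; apply/andP; split; last exact: H.
by rewrite lerNl opprB distrC H.
Qed.

(** At [p = 5] the slope is [5 u^3 |u|]. The constant is [64 + 5 * 64], from the factor [p] and from
    the exponent. *)
Lemma powR_slope_near5 p u : `|p - 5| <= 1 -> `|u| <= 2 ->
  `|powR_slope p u - 5 * u ^+ 3 * `|u| | <= 384 * `|p - 5|.
Proof.
rewrite ler_norml => /andP[p4 p6] u2.
have t2 : 0 <= `|u| <= 2 by rewrite normr_ge0.
have -> : 5 * u ^+ 3 * `|u| = 5 * `|u| `^ 4 * Num.sg u.
  rewrite (powR_mulrn 4) ?normr_ge0// {1}(numEsg u) exprMn.
  have [->|u0] := eqVneq u 0; first by rewrite sgr0 normr0; ring.
  have -> : Num.sg u ^+ 3 = Num.sg u by rewrite exprSr sqr_sg u0 mul1r.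
  ring.
rewrite /powR_slope -mulrBl normrM normr_sg.
apply: (@le_trans _ _ `|p * `|u| `^ (p - 1) - 5 * `|u| `^ 4|).
  by rewrite ler_piMr// lern1 leq_b1.
have -> : p * `|u| `^ (p - 1) - 5 * `|u| `^ 4 =
  (p - 5) * `|u| `^ (p - 1) + 5 * (`|u| `^ (p - 1) - `|u| `^ 4) by ring.
have h : `|(`|u| `^ (p - 1) - `|u| `^ 4)| <= 64 * `|p - 5|.
  have -> : p - 5 = p - 1 - 4 by ring.
  by apply: powR_exponent_lipschitz; lra.
have h6 : `|u| `^ (p - 1) <= 64.
  have [u1|u1] := leP `|u| 1.
    apply: (@le_trans _ _ (1 `^ (p - 1))); last by rewrite powR1; lra.
    by rewrite ge0_ler_powR ?nnegrE//; lra.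
  apply: (@le_trans _ _ (`|u| `^ 6%:R)); first by apply: ler_powR; lra.
  rewrite powR_mulrn//; apply: (@le_trans _ _ (2 ^+ 6)); last by rewrite -natrX.
  by rewrite lerXn2r ?nnegrE.
apply: le_trans (ler_normD _ _) _; rewrite !normrM (ger0_norm (powR_ge0 _ _)).
rewrite (ger0_norm (_ : 0 <= 5 :> R))//.
have := ler_wpM2l (normr_ge0 (p - 5)) h6; lra.
Qed.

(** The derivative [20 |u|^3] is at most 160 on this range; the proof splits the difference
    algebraically. *)
Lemma norm_cube_norm_lipschitz u v : `|u| <= 2 -> `|v| <= 2 ->
  `|5 * u ^+ 3 * `|u| - 5 * v ^+ 3 * `|v| | <= 160 * `|u - v|.
Proof.
move=> u2 v2.
have -> : 5 * u ^+ 3 * `|u| - 5 * v ^+ 3 * `|v| =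
  5 * (u ^+ 3 * (`|u| - `|v|) + `|v| * (u ^+ 2 + u * v + v ^+ 2) * (u - v)) by ring.
rewrite normrM (ger0_norm (_ : 0 <= 5 :> R))//.
have -> : 160 * `|u - v| = 5 * (8 * `|u - v| + 24 * `|u - v|) by ring.
rewrite ler_wpM2l//; apply: le_trans (ler_normD _ _) _; apply: lerD.
  rewrite normrM ler_pM// ?lerB_normD//.
    rewrite normrX; apply: (@le_trans _ _ (2 ^+ 3)); last by rewrite -natrX.
    by rewrite lerXn2r ?nnegrE.
  exact: ler_dist_dist.
rewrite normrM ler_wpM2r// normrM normr_id.
have -> : 24 = 2 * 12 :> R by ring.
rewrite ler_pM//; apply: le_trans (ler_normD _ _) _.
have := ler_normD (u ^+ 2) (u * v).
rewrite (normrM u v) (normrX 2 u) (normrX 2 v).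
have := normr_ge0 u; have := normr_ge0 v.
by move: `|u| `|v| u2 v2 => x y x2 y2 y0 x0; nra.
Qed.

(** The slope is frozen at [p = 5] and at [w], so that one constant matrix can serve as Jacobian for
    all nearby [p] and points. *)
Lemma normr_powR_linear_approx5 p u v w d : `|p - 5| <= 1 ->
  `|u| <= 2 -> `|v| <= 2 -> `|w| <= 2 -> `|u - w| <= d -> `|v - w| <= d ->
  `| `|u| `^ p - `|v| `^ p - 5 * w ^+ 3 * `|w| * (u - v)|
    <= (160 * d + 384 * `|p - 5|) * `|u - v|.
Proof.
move=> p5 u2 v2 w2 uw vw; have p1 : 1 < p by move: p5; rewrite ler_norml; lra.
have H x : `|x| <= 2 -> `|x - w| <= d ->
    `|powR_slope p x - 5 * w ^+ 3 * `|w| | <= 160 * d + 384 * `|p - 5|.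
  move=> x2 xw; rewrite -(subrKA (5 * x ^+ 3 * `|x|)).
  apply: le_trans (ler_normD _ _) _; rewrite addrC lerD ?powR_slope_near5//.
  by apply: le_trans (norm_cube_norm_lipschitz x2 w2) _; lra.
by apply: normr_powR_linear_approx; rewrite ?H.
Qed.

End Tangent.

(** * Newton iteration *)

(* Matrices are complete and normed in the library, but the join of the two
   structures is declared only here. *)
HB.instance Definition _ (R : realType) (m n : nat) := Complete.on 'M[R]_(m, n).

Section Newton.
Variables (R : realType) (m : nat).
Local Notation V := 'rV[R]_m.+1.

Lemma norm_rV_le (x : V) c : 0 <= c -> (forall k, `|x 0 k| <= c) -> `|x| <= c.
Proof.
move=> c0 h; rewrite /Num.norm/= mx_normrE (bigmax_le _ c0)// => -[i j] _ /=.
by rewrite (ord1 i).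
Qed.

Lemma le_norm_rV (x : V) k : `|x 0 k| <= `|x|.
Proof.
rewrite [leRHS]/Num.norm/= mx_normrE.
exact: (le_trans _ (le_bigmax _ (fun ij => `|x ij.1 ij.2|) (0, k))).
Qed.

(** Row vectors carry the maximum norm, for which right multiplication is controlled by column
    sums. *)
Lemma norm_mulmx_le (A : 'M[R]_m.+1) a (x : V) :
  (forall k, \sum_l `|A l k| <= a) -> `|x *m A| <= a * `|x|.
Proof.
move=> h; have a0 : 0 <= a.
  by apply: le_trans (h ord0); apply: sumr_ge0 => l _; rewrite normr_ge0.
apply: norm_rV_le => [|k]; first by rewrite mulr_ge0.
rewrite mxE; apply: le_trans (ler_norm_sum _ _ _) _.
apply: le_trans (ler_wpM2r (normr_ge0 x) (h k)); rewrite mulr_suml.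
by apply: ler_sum => l _; rewrite normrM mulrC ler_wpM2l// le_norm_rV.
Qed.

(** The map [x - F x *m A], with [A] a fixed approximate inverse of [J], has Lipschitz constant
    [1/4 + 1/4] and moves [x0] by at most [r / 2]. It therefore contracts the closed ball into
    itself, and its fixed point is a zero of [F] because [A] is invertible. *)
Lemma newton_zero (F : V -> V) (J A : 'M[R]_m.+1) (x0 : V) (a K r : R) :
  0 < r -> a * K <= 4^-1 ->
  (forall x y, `|x - x0| <= r -> `|y - x0| <= r ->
     `|F x - F y - (x - y) *m J| <= K * `|x - y|) ->
  (forall k, \sum_l `|(1%:M - J *m A) l k| <= 4^-1) ->
  (forall k, \sum_l `|A l k| <= a) ->
  `|F x0 *m A| <= r / 2 ->
  exists x, F x = 0.
Proof.
move=> r0 aK FJ JA Aa Fx0.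
have Aunit : A \in unitmx.
  (* A vector killed by [J *m A] would satisfy [|v| <= |v| / 4]. *)
  have : J *m A \in unitmx; last by rewrite unitmx_mul => /andP[].
  rewrite -row_free_unit -kermx_eq0; apply/negPn/negP => /rowV0Pn[v].
  move=> /sub_kermxP vJA v0; have := norm_mulmx_le v JA.
  rewrite mulmxBr mulmx1 vJA subr0 => h.
  have : 0 < `|v| by rewrite normr_gt0.
  lra.
pose T x := x - F x *m A.
have TT x y : `|x - x0| <= r -> `|y - x0| <= r -> `|T x - T y| <= 2^-1 * `|x - y|.
  move=> xr yr.
  have -> : T x - T y = (x - y) *m (1%:M - J *m A) - (F x - F y - (x - y) *m J) *m A.
    have -> : T x - T y = x - y - (F x - F y) *m A.
      by rewrite mulmxBl /T opprD addrACA -opprD.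
    rewrite -[F x - F y in LHS](subrK ((x - y) *m J)) mulmxDl -mulmxA.
    by rewrite mulmxBr mulmx1 opprD addrA addrAC.
  apply: le_trans (ler_normB _ _) _.
  have h1 := norm_mulmx_le (x - y) JA.
  have h2 := norm_mulmx_le (F x - F y - (x - y) *m J) Aa.
  have a0 : 0 <= a.
    by apply: le_trans (Aa ord0); apply: sumr_ge0 => l _; rewrite normr_ge0.
  have h3 := ler_wpM2l a0 (FJ _ _ xr yr).
  have h4 := ler_wpM2r (normr_ge0 (x - y)) aK.
  lra.
pose U := closed_ball x0 r.
have UE x : U x <-> `|x - x0| <= r by rewrite /U closed_ballE// /closed_ball_ /= distrC.
have Tfun : set_fun U U T.
  move=> x /UE xU; apply/UE; rewrite -(subrKA (T x0)).
  apply: le_trans (ler_normD _ _) _.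
  have h := TT x x0 xU; rewrite subrr normr0 (ltW r0) in h.
  have {}h := h isT.
  have -> : T x0 - x0 = - (F x0 *m A) by rewrite /T addrAC subrr add0r.
  rewrite normrN; lra.
have [q qE] : exists q : {nonneg R}, q%:num = 2^-1 by exists (2^-1)%:nng.
have Tc : is_contraction (mkfun_fun Tfun).
  exists q; split; first by rewrite qE; lra.
  by move=> [x y] [/= /UE xU /UE yU]; rewrite qE; exact: TT.
have Uc : closed U by exact: closed_ball_closed.
have [|x xU xT] := banach_fixed_point Tc Uc.
  by exists x0; apply/UE; rewrite subrr normr0 ltW.
exists x; apply: (can_inj (mulmxK Aunit)); rewrite mul0mx.
have {xT} : x = x - F x *m A by [].
by move/eqP; rewrite eq_sym subr_eq addrC -subr_eq subrr eq_sym => /eqP.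
Qed.

End Newton.

(** * Integer certificates *)

Delimit Scope Z_scope with ZZ.

Definition sumZ (s : seq Z) : Z := foldr Z.add 0%ZZ s.

(* The code 0 stands for the number 0, and k.+1 and - k.+1 stand for the k-th
   variable and its opposite.  A pair of codes stands for the absolute value of a
   difference, so (a, b), (b, a), (-a, -b) and (-b, -a) have the same key. *)
Definition pair_key (c : Z * Z) : Z :=
  Z.max (Z.abs (100 * c.1 + c.2)%ZZ) (Z.abs (100 * c.2 + c.1)%ZZ).

(** A sum over coordinates depends only on the multiset of pairs, which sorting puts in a normal
    form. *)
Definition row_key (s : seq (Z * Z)) : seq Z := sort Z.leb (map pair_key s).

HB.lock Definition ZR (R : realType) (z : Z) : R := (int_of_Z z)%:~R.

Section ZRTheory.
Variable R : realType.
Local Notation ZR := (ZR R).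

Lemma ZR_nat n : ZR (Z.of_nat n) = n%:R.
Proof. by rewrite ZR.unlock; case: n => [|n] //=; rewrite SuccNat2Pos.id_succ. Qed.
Lemma ZR0 : ZR 0 = 0. Proof. exact: (ZR_nat 0). Qed.
Lemma ZR1 : ZR 1 = 1. Proof. exact: (ZR_nat 1). Qed.
Lemma ZRD a b : ZR (a + b)%ZZ = ZR a + ZR b.
Proof. by rewrite ZR.unlock -intrD -rmorphD. Qed.
Lemma ZRN a : ZR (- a)%ZZ = - ZR a.
Proof. by rewrite ZR.unlock -intrN -rmorphN. Qed.
Lemma ZRB a b : ZR (a - b)%ZZ = ZR a - ZR b.
Proof. by rewrite -Z.add_opp_r ZRD ZRN. Qed.
Lemma ZRM a b : ZR (a * b)%ZZ = ZR a * ZR b.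
Proof. by rewrite ZR.unlock -intrM -rmorphM. Qed.
Lemma ZRX a n : ZR (a ^ Z.of_nat n)%ZZ = ZR a ^+ n.
Proof.
elim: n => [|n IH]; first exact: (ZR_nat 1).
by rewrite Nat2Z.inj_succ Z.pow_succ_r ?ZRM ?IH ?exprS//; lia.
Qed.
Lemma ZR_ge0 a : (0 <=? a)%ZZ -> 0 <= ZR a.
Proof. by rewrite ZR.unlock; case: a => // q _; rewrite ler0z. Qed.
Lemma ZR_gt0 a : (0 <? a)%ZZ -> 0 < ZR a.
Proof.
rewrite ZR.unlock; case: a => // q _; rewrite ltr0z ltz_nat.
by have := Pos2Nat.is_pos q; lia.
Qed.
Lemma ZR_le a b : (a <=? b)%ZZ -> ZR a <= ZR b.
Proof. by move=> ab; rewrite -subr_ge0 -ZRB ZR_ge0//; lia. Qed.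
Lemma ZR_abs a : ZR (Z.abs a) = `|ZR a|.
Proof.
have [a0|a0] : (0 <=? a \/ a <=? 0)%ZZ by lia.
  by rewrite ger0_norm ?ZR_ge0//; congr ZR; lia.
by rewrite ler0_norm -?ZRN; [congr ZR; lia|rewrite -ZR0; exact: ZR_le].
Qed.
Lemma ZR_sumZ (T : Type) (f : T -> Z) (s : seq T) :
  ZR (sumZ (map f s)) = \sum_(c <- s) ZR (f c).
Proof.
by elim: s => [|c s IH]; rewrite ?big_nil ?big_cons /= ?ZR0 ?ZRD ?IH.
Qed.

End ZRTheory.

Section Configuration.
Variables (R : realType) (v : nat -> R) (p : R).

(** For the code 0 the index falls on variable 0, and the sign 0 makes the value 0. *)
Definition code_val (c : Z) : R := ZR R (Z.sgn c) * v (Z.abs_nat c).-1.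
Definition pair_dist (c : Z * Z) : R := `|code_val c.1 - code_val c.2| `^ p.

Lemma code_valN c : code_val (- c)%ZZ = - code_val c.
Proof. by rewrite /code_val Z.sgn_opp ZRN mulNr; case: c. Qed.

(** Rounding to the nearest multiple of 100 recovers [(a, b)] from [100 a + b] when [|b| < 50]. *)
Definition key_decode (k : Z) : Z * Z :=
  let a := ((k + 50) / 100)%ZZ in (a, (k - 100 * a)%ZZ).

Definition small_code (c : Z) : bool := (Z.abs c <? 50)%ZZ.

Lemma key_decodeE a b : small_code b -> key_decode (100 * a + b)%ZZ = (a, b).
Proof.
rewrite /small_code /key_decode => b50.
have <- : (a = (100 * a + b + 50) / 100)%ZZ.
  by apply: (Zdiv_unique _ _ _ (b + 50)%ZZ); lia.
by congr pair; lia.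
Qed.

Lemma pair_dist_key (c : Z * Z) : small_code c.1 -> small_code c.2 ->
  pair_dist (key_decode (pair_key c)) = pair_dist c.
Proof.
case: c => a b /= a50 b50; rewrite /pair_key /=.
have Na : small_code (- a)%ZZ by move: a50; rewrite /small_code; lia.
have Nb : small_code (- b)%ZZ by move: b50; rewrite /small_code; lia.
have : (Z.max (Z.abs (100 * a + b)) (Z.abs (100 * b + a)) = 100 * a + b \/
  Z.max (Z.abs (100 * a + b)) (Z.abs (100 * b + a)) = 100 * b + a \/
  Z.max (Z.abs (100 * a + b)) (Z.abs (100 * b + a)) = 100 * - a + - b \/
  Z.max (Z.abs (100 * a + b)) (Z.abs (100 * b + a)) = 100 * - b + - a)%ZZ by lia.
case=> [->|[->|[->|->]]]; rewrite key_decodeE// /pair_dist /= ?code_valN.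
- by rewrite distrC.
- by rewrite -opprD normrN.
- by rewrite -opprD normrN distrC.
Qed.

Lemma eq_row_key_sum s t :
  all (fun c => small_code c.1 && small_code c.2) s ->
  all (fun c => small_code c.1 && small_code c.2) t ->
  row_key s = row_key t ->
  \sum_(c <- s) pair_dist c = \sum_(c <- t) pair_dist c.
Proof.
move=> s50 t50 st.
have H u : all (fun c => small_code c.1 && small_code c.2) u ->
    \sum_(c <- u) pair_dist c = \sum_(k <- map pair_key u) pair_dist (key_decode k).
  move=> /allP u50; rewrite big_map big_seq [RHS]big_seq; apply: eq_bigr => c.
  by move=> /u50/andP[c1 c2]; rewrite pair_dist_key.
rewrite !H//; apply: perm_big; rewrite -(perm_sort Z.leb) -/(row_key s) st.
by rewrite perm_sort.
Qed.

End Configuration.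

(** The derivative of the value of [c] with respect to the variable [k]. *)
Definition code_coef (k : nat) (c : Z) : Z :=
  if (Z.abs_nat c == k.+1) then Z.sgn c else 0%ZZ.

Section IntegerData.
Variables (system : nat -> seq (Z * Z)) (approx : nat -> Z) (scale : Z).

Definition code_approx (c : Z) : Z := (Z.sgn c * approx (Z.abs_nat c).-1)%ZZ.

Definition diff_approx (c : Z * Z) : Z := (code_approx c.1 - code_approx c.2)%ZZ.

(** The defect of equation [e] at [p = 5] and the approximate solution, times [scale ^ 5]. *)
Definition residual (e : nat) : Z :=
  (sumZ [seq Z.abs (diff_approx c) ^ 5 | c <- system e] - scale ^ 5)%ZZ.

(** The partial derivative of equation [e] in the variable [k], at [p = 5] and the approximate
    solution, times [scale ^ 4]. *)
Definition slope_sum (k e : nat) : Z :=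
  sumZ [seq (5 * diff_approx c ^ 3 * Z.abs (diff_approx c) *
             (code_coef k c.1 - code_coef k c.2))%ZZ | c <- system e].

End IntegerData.

(** * From integer inequalities to a zero of the system *)

Section System.
Variables (R : realType) (system : nat -> seq (Z * Z)) (approx : nat -> Z).
Variables (inv_entry : nat -> nat -> Z) (scale scaleJ : Z).
Local Notation I11 := (iota 0 11).
Local Notation code_approx := (code_approx approx).
Local Notation diff_approx := (diff_approx approx).
Local Notation residual := (residual system approx scale).
Local Notation slope_sum := (slope_sum system approx).

Hypothesis scale_gt0 : (0 <? scale)%ZZ.
Hypothesis scaleJ_gt0 : (0 <? scaleJ)%ZZ.
Hypothesis size_system : forall e, e \in I11 -> size (system e) = 56.
(** With denominators cleared: coordinate differences at most 1, defects at most [10^-9], column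
    sums of the approximate inverse at most 20, and those of [1 - J A] at most [1/4]. *)
Hypothesis diff_approx_le : forall e c, e \in I11 -> c \in system e ->
  (Z.abs (diff_approx c) <=? scale)%ZZ.
Hypothesis residual_le : forall e, e \in I11 ->
  (Z.abs (residual e) * 10 ^ 9 <=? scale ^ 5)%ZZ.
Hypothesis inv_entry_le : forall l, l \in I11 ->
  (sumZ [seq Z.abs (inv_entry e l) | e <- I11] <=? 20 * scaleJ)%ZZ.
Hypothesis slope_inv_le : forall l, l \in I11 ->
  (sumZ [seq Z.abs ((if k == l then scale ^ 4 * scaleJ else 0) -
     sumZ [seq slope_sum k e * inv_entry e l | e <- I11]) | k <- I11] * 4
   <=? scale ^ 4 * scaleJ)%ZZ.

Local Notation V := 'rV[R]_11.

Let S : R := ZR R scale.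

Let S_gt0 : 0 < S.
Proof. exact: ZR_gt0. Qed.

Definition approx_val (k : nat) : R := ZR R (approx k) / S.

(** The first eleven variables are unknowns; the later ones keep their listed values exactly. *)
Definition var_val (x : V) (k : nat) : R :=
  if (k < 11)%N then x 0 (inord k) else approx_val k.

Definition approx_point : V := \row_k approx_val k.

Lemma var_val_approx_point k : var_val approx_point k = approx_val k.
Proof. by rewrite /var_val; case: ifP => // k11; rewrite mxE inordK. Qed.

Definition diff_val (x : V) (c : Z * Z) : R :=
  code_val (var_val x) c.1 - code_val (var_val x) c.2.

Lemma code_val_x0 c : code_val (var_val approx_point) c = ZR R (code_approx c) / S.
Proof. by rewrite /code_val var_val_approx_point /code_approx ZRM mulrA. Qed.

Lemma diff_val_x0 c : diff_val approx_point c = ZR R (diff_approx c) / S.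
Proof. by rewrite /diff_val !code_val_x0 -mulrBl -ZRB. Qed.

Lemma code_val_sub x y c : code_val (var_val x) c - code_val (var_val y) c =
  \sum_(k < 11) (x - y) 0 k * ZR R (code_coef k c).
Proof.
rewrite /code_val -mulrBr /code_coef.
case: (posnP (Z.abs_nat c)) => [c0|].
  have -> : c = 0%ZZ by lia.
  by rewrite ZR0 mul0r big1// => k _; rewrite mulr0.
move: (Z.abs_nat c) => [//|n] _ /=; rewrite /var_val.
case: ifP => n11.
  rewrite (bigD1 (inord n))//= inordK// eqxx big1 ?addr0 => [|k kn].
    by rewrite !mxE mulrC.
  rewrite ifN ?ZR0 ?mulr0//; apply: contra kn => /eqP[->].
  by apply/eqP/val_inj; rewrite /= inordK.
rewrite subrr mulr0 big1// => k _; rewrite ifN ?ZR0 ?mulr0//.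
by apply/eqP => -[nk]; move: (ltn_ord k); rewrite -nk n11.
Qed.

Lemma code_val_lipschitz x y c :
  `|code_val (var_val x) c - code_val (var_val y) c| <= `|x - y|.
Proof.
rewrite /code_val -mulrBr normrM -ZR_abs.
apply: (@le_trans _ _ (1 * `|var_val x (Z.abs_nat c).-1 - var_val y (Z.abs_nat c).-1|)).
  by rewrite ler_wpM2r// -(ZR1 R) ZR_le//; lia.
rewrite mul1r /var_val; case: ifP => k11; last by rewrite subrr normr0.
have := le_norm_rV (x - y) (inord (Z.abs_nat c).-1).
by rewrite !mxE.
Qed.

Lemma diff_val_sub x y c : diff_val x c - diff_val y c =
  \sum_(k < 11) (x - y) 0 k * ZR R (code_coef k c.1 - code_coef k c.2)%ZZ.
Proof.
have -> : diff_val x c - diff_val y c =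
  (code_val (var_val x) c.1 - code_val (var_val y) c.1) -
  (code_val (var_val x) c.2 - code_val (var_val y) c.2) by rewrite /diff_val; ring.
by rewrite !code_val_sub -sumrB; apply: eq_bigr => k _; rewrite ZRB mulrBr.
Qed.

Lemma diff_val_lipschitz x y c : `|diff_val x c - diff_val y c| <= 2 * `|x - y|.
Proof.
have -> : diff_val x c - diff_val y c =
  (code_val (var_val x) c.1 - code_val (var_val y) c.1) -
  (code_val (var_val x) c.2 - code_val (var_val y) c.2) by rewrite /diff_val; ring.
apply: le_trans (ler_normB _ _) _; rewrite mulr2n mulrDl mul1r.
by rewrite lerD ?code_val_lipschitz.
Qed.

Definition system_map (p : R) (x : V) : V :=
  \row_e (\sum_(c <- system e) `|diff_val x c| `^ p - 1).

Definition jac : 'M[R]_11 := \matrix_(k, e) (ZR R (slope_sum k e) / S ^+ 4).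

Let T : R := ZR R scaleJ.
Let T_gt0 : 0 < T.
Proof. exact: ZR_gt0. Qed.

Definition jac_inv : 'M[R]_11 := \matrix_(e, l) (ZR R (inv_entry e l) / T).

Lemma mem_I11 (e : 'I_11) : (e : nat) \in iota 0 11.
Proof. by rewrite mem_iota; exact: ltn_ord. Qed.

Lemma sum_I11 (f : nat -> R) : \sum_(e < 11) f e = \sum_(e <- iota 0 11) f e.
Proof. by rewrite -(big_mkord xpredT f) /index_iota subn0. Qed.

Lemma diff_val_x0_le1 (e : 'I_11) c : c \in system e -> `|diff_val approx_point c| <= 1.
Proof.
move=> cs; rewrite diff_val_x0 normrM (gtr0_norm (x := S^-1)) ?invr_gt0//.
by rewrite ler_pdivrMr// mul1r -ZR_abs ZR_le// (@diff_approx_le e)// mem_I11.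
Qed.

Lemma jac_inv_le (l : 'I_11) : \sum_e `|jac_inv e l| <= 20.
Proof.
have /ZR_le-/(_ R) := inv_entry_le (mem_I11 l).
rewrite ZRM ZR_sumZ (ZR_nat R 20) -/T => h.
under eq_bigr => e _ do rewrite mxE normrM (gtr0_norm (x := T^-1)) ?invr_gt0// -ZR_abs.
rewrite -mulr_suml ler_pdivrMr// (sum_I11 (fun e => ZR R (Z.abs (inv_entry e l)))).
exact: h.
Qed.

Lemma sub_jac_mul_le (l : 'I_11) : \sum_k `|(1%:M - jac *m jac_inv) k l| <= 4^-1.
Proof.
have /ZR_le-/(_ R) := slope_inv_le (mem_I11 l).
rewrite ZRM ZR_sumZ (ZR_nat R 4) ZRM (ZRX R scale 4) -/S -/T => h.
have ST : 0 < S ^+ 4 * T by rewrite mulr_gt0 ?exprn_gt0.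
pose D (k : nat) := ((if k == l then scale ^ 4 * scaleJ else 0) -
  sumZ [seq slope_sum k e * inv_entry e l | e <- I11])%ZZ.
have E (k : 'I_11) : (1%:M - jac *m jac_inv) k l = ZR R (D k) / (S ^+ 4 * T).
  rewrite !mxE /D ZRB ZR_sumZ -(sum_I11 (fun e => ZR R (slope_sum k e * inv_entry e l))).
  rewrite mulrBl mulr_suml; congr (_ - _); last first.
    by apply: eq_bigr => e _; rewrite !mxE ZRM; field; rewrite !gt_eqF.
  have [->|kl] := eqVneq k l; first by rewrite eqxx ZRM (ZRX R scale 4) divff ?gt_eqF.
  by rewrite ifN ?ZR0 ?mul0r.
under eq_bigr => k _ do
  rewrite E normrM (gtr0_norm (x := (_ * T)^-1)) ?invr_gt0// -ZR_abs.
rewrite -mulr_suml ler_pdivrMr// (sum_I11 (fun k => ZR R (Z.abs (D k)))).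
by rewrite mulrC ler_pdivlMr.
Qed.

(** The defect at [p = 5], plus the change of exponent in 56 terms: [3584 = 56 * 64]. *)
Lemma system_map_x0 p : `|p - 5| <= 1 ->
  `|system_map p approx_point| <= 10 ^- 9 + 3584 * `|p - 5|.
Proof.
move=> p5; have p16 : 1 <= p <= 6 by move: p5; rewrite ler_norml; lra.
apply: norm_rV_le => [|e].
  by rewrite addr_ge0 ?mulr_ge0 ?ler0n ?normr_ge0 ?invr_ge0 ?exprn_ge0 ?ler0n.
have -> : system_map p approx_point 0 e =
    (\sum_(c <- system e) `|diff_val approx_point c| ^+ 5 - 1) +
    \sum_(c <- system e)
      (`|diff_val approx_point c| `^ p - `|diff_val approx_point c| ^+ 5).
  by rewrite mxE sumrB; ring.
apply: le_trans (ler_normD _ _) _; apply: lerD.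
  have /ZR_le-/(_ R) := residual_le (mem_I11 e).
  rewrite ZRM ZR_abs (ZRX R scale 5) -/S (ZRX R 10 9) (ZR_nat R 10) => h.
  have -> : \sum_(c <- system e) `|diff_val approx_point c| ^+ 5 - 1 =
      ZR R (residual e) / S ^+ 5.
    rewrite /residual ZRB ZR_sumZ (ZRX R scale 5) -/S mulrBl divff ?expf_neq0 ?gt_eqF//.
    congr (_ - 1); rewrite mulr_suml; apply: eq_bigr => c _.
    rewrite (ZRX R _ 5) ZR_abs diff_val_x0 normrM (gtr0_norm (x := S^-1)) ?invr_gt0//.
    by rewrite expr_div_n.
  rewrite normrM (gtr0_norm (x := (S ^+ 5)^-1)) ?invr_gt0 ?exprn_gt0//.
  by rewrite ler_pdivrMr ?exprn_gt0// mulrC ler_pdivlMr ?exprn_gt0.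
apply: le_trans (ler_norm_sum _ _ _) _.
apply: (@le_trans _ _ (\sum_(c <- system e) 64 * `|p - 5|)).
  rewrite big_seq [leRHS]big_seq; apply: ler_sum => c cs.
  rewrite -(powR_mulrn 5) ?normr_ge0//; apply: powR_exponent_lipschitz => //; last lra.
  by rewrite normr_ge0 (le_trans (diff_val_x0_le1 cs))// ler1n.
rewrite big_const_seq count_predT size_system ?mem_I11// iter_addr_0.
by rewrite -mulr_natr; lra.
Qed.

(** A difference of two codes is 2-Lipschitz in the point, which turns [r] into [2 * r] and 56 terms
    into the factor 112; [r <= 1/4] keeps differences below 2. *)
Lemma system_map_approx p r x y : `|p - 5| <= 1 -> r <= 4^-1 ->
  `|x - approx_point| <= r -> `|y - approx_point| <= r ->
  `|system_map p x - system_map p y - (x - y) *m jac|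
     <= 112 * (320 * r + 384 * `|p - 5|) * `|x - y|.
Proof.
move=> p5 r4 xr yr; have r0 : 0 <= r by apply: le_trans xr.
apply: norm_rV_le => [|e].
  apply: mulr_ge0; last exact: normr_ge0.
  by have := normr_ge0 (p - 5); lra.
have -> : (system_map p x - system_map p y - (x - y) *m jac) 0 e =
   \sum_(c <- system e) (`|diff_val x c| `^ p - `|diff_val y c| `^ p -
      5 * diff_val approx_point c ^+ 3 * `|diff_val approx_point c| *
      (diff_val x c - diff_val y c)).
  rewrite !sumrB.
  have -> : \sum_(c <- system e)
      5 * diff_val approx_point c ^+ 3 * `|diff_val approx_point c| *
      (diff_val x c - diff_val y c) = ((x - y) *m jac) 0 e.
    under eq_bigr => c _ do rewrite diff_val_sub mulr_sumr.
    rewrite exchange_big mxE; apply: eq_bigr => k _.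
    rewrite [jac k e]mxE /slope_sum ZR_sumZ mulr_suml mulr_sumr; apply: eq_bigr => c _.
    rewrite diff_val_x0 normrM (gtr0_norm (x := S^-1)) ?invr_gt0//.
    rewrite 3!ZRM ZR_abs (ZRX R (diff_approx c) 3) expr_div_n (ZR_nat R 5).
    by field; rewrite gt_eqF.
  by rewrite !mxE; ring.
apply: le_trans (ler_norm_sum _ _ _) _.
apply: (@le_trans _ _ (\sum_(c <- system e)
    (160 * (2 * r) + 384 * `|p - 5|) * (2 * `|x - y|))).
  rewrite big_seq [leRHS]big_seq; apply: ler_sum => c cs.
  have w1 := diff_val_x0_le1 cs.
  have closex z : `|z - approx_point| <= r ->
      `|diff_val z c - diff_val approx_point c| <= 2 * r.
    by move=> zr; apply: le_trans (diff_val_lipschitz _ _ _) _; rewrite ler_wpM2l.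
  have le2 z : `|z - approx_point| <= r -> `|diff_val z c| <= 2.
    move=> /closex zr; rewrite -(subrK (diff_val approx_point c) (diff_val z c)).
    by apply: le_trans (ler_normD _ _) _; lra.
  apply: le_trans (normr_powR_linear_approx5 p5 _ _ _ (closex _ xr) (closex _ yr)) _.
  - exact: le2. - exact: le2. - by rewrite (le_trans w1)// ler1n.
  apply: ler_wpM2l; last exact: diff_val_lipschitz.
  by have := normr_ge0 (p - 5); lra.
rewrite big_const_seq count_predT size_system ?mem_I11// iter_addr_0.
by rewrite -mulr_natr; lra.
Qed.

Lemma system_zero p : `|p - 5| < 10 ^- 13 -> exists x, system_map p x = 0.
Proof.
move=> p5.
have e13 : 0 < (10 ^- 13 : R) by rewrite invr_gt0 exprn_gt0.
have e7 : (10 ^- 7 : R) = 10 ^+ 6 * 10 ^- 13 by field.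
have e9 : (10 ^- 9 : R) = 10 ^+ 4 * 10 ^- 13 by field.
have e0 : 10 ^+ 13 * 10 ^- 13 = 1 :> R by field.
(* With radius [10^-7], [a * K] is about 0.072, and the first step is at most about [2.8 * 10^-8],
   below half the radius. *)
apply: (@newton_zero R 10 (system_map p) jac jac_inv approx_point 20
  (112 * (320 * 10 ^- 7 + 384 * `|p - 5|)) (10 ^- 7)).
- by rewrite invr_gt0 exprn_gt0.
- lra.
- move=> x y; apply: system_map_approx; lra.
- exact: sub_jac_mul_le.
- exact: jac_inv_le.
apply: le_trans (norm_mulmx_le _ jac_inv_le) _.
have := @system_map_x0 p; lra.
Qed.

End System.

(** * The configuration *)

(* Variables, in order: d, a, b (diagonal, square and non-square entries of the
   Paley rows), z1, u, w, e, f, ta, y0, y1; then z0 = -1/4 and sg = 1/2, which are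
   kept fixed. *)
Definition paley_code (i j : nat) : Z :=
  let d := ((j + 23 - i) %% 23)%N in
  (if d == 0%N then 1
   else if d \in [seq (k ^ 2 %% 23)%N | k <- iota 1 22] then 2 else 3)%ZZ.

Definition half_row (i : nat) : seq Z :=
  if (i < 23)%N then
    [seq paley_code i j | j <- iota 0 23] ++ nseq 23 0%ZZ ++ nseq 5 12%ZZ ++ nseq 5 4%ZZ
  else if (i < 28)%N then
    nseq 23 5%ZZ ++ nseq 23 6%ZZ ++
    [seq (if j == (i - 23)%N then 7 else 8)%ZZ | j <- iota 0 5] ++ nseq 5 0%ZZ
  else nseq 23 13%ZZ ++ nseq 23 9%ZZ ++ nseq 5 10%ZZ ++ nseq 5 11%ZZ.

Definition mirror (s : seq Z) : seq Z :=
  [seq Z.opp c | c <- rot 23 (take 46 s) ++ rot 5 (drop 46 s)].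

Definition codes : seq (seq Z) :=
  let h := [seq half_row i | i <- iota 0 29] in h ++ map mirror h.

Definition row_pairs (i j : nat) : seq (Z * Z) :=
  zip (nth [::] codes i) (nth [::] codes j).

(** One pair for each distance. Indices 0 to 22 are tournament points, 23 to 27 and 28 the other two
    kinds; adding 29 gives the mirror image. *)
Definition representatives : seq (nat * nat) :=
  [:: (0, 1); (0, 23); (0, 28); (0, 29); (23, 24); (23, 28); (23, 29); (23, 52);
      (28, 29); (28, 52); (28, 57)]%N.

Definition config_system (e : nat) : seq (Z * Z) :=
  let r := nth (0, 0)%N representatives e in row_pairs r.1 r.2.

(* Values at p = 5, times 10^10. *)
Definition config_approx (k : nat) : Z :=
  nth 0%ZZ [:: 8670479938; -1013308588; 2330347613; 4650710336; 1910159695;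
    -4921404797; 2267343567; -6438162066; -955677891; -7068350416; 1570550956;
    -2500000000; 5000000000]%ZZ k.

(* The inverse of the Jacobian matrix at p = 5, times 10^4. *)
Definition config_inv (e l : nat) : Z := nth 0%ZZ (nth [::] [::
 [:: 2211; 1130; -35187; -9969; -1486; -1338; 780; 780; -2313; 446; -3562];
 [:: 1067; 1701; -25717; 21805; -4303; 2757; 427; 427; 354; -183; 659];
 [:: -805; -982; 6647; 22269; -4478; 4219; 72; 72; 1803; -490; 2919];
 [:: -558; -1520; 40034; 1398; -300; 276; 7; 7; 113; -31; 184];
 [:: 249; 402; -6204; 5701; 1312; 965; 1119; -622; 124; 127; 40];
 [:: -194; -315; 4938; -4782; -3579; -537; 1137; 1137; -120; -196; 34];
 [:: -865; -1378; 20791; -17473; 5988; -3630; -651; -651; -272; 208; -575];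
 [:: -324; -513; 7664; -6177; -1340; -935; -832; -832; -77; 179; -283];
 [:: 391; 653; -10680; 11812; 7759; 1414; -2534; -2534; 6150; -1091; 9375];
 [:: 268; 382; -4531; -380; 3228; -328; -801; -801; -309; -1672; 1256];
 [:: -21; -38; 700; -1033; -511; -137; 179; 179; -23; 395; -2616]]%ZZ e) l.

Definition config_scale : Z := (10 ^ 10)%ZZ.
Definition config_scaleJ : Z := (10 ^ 4)%ZZ.

Local Notation I11 := (iota 0 11).

Lemma config_size e : e \in I11 -> size (config_system e) = 56.
Proof. by move=> h; apply/eqP; move: e h; apply/allP; vm_compute. Qed.

Lemma config_diff_le e c : e \in I11 -> c \in config_system e ->
  (Z.abs (diff_approx config_approx c) <=? config_scale)%ZZ.
Proof.
move=> h; move: c; apply/allP; move: e h; apply/allP; by vm_compute.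
Qed.

Lemma config_residual_le e : e \in I11 ->
  (Z.abs (residual config_system config_approx config_scale e) * 10 ^ 9 <=?
   config_scale ^ 5)%ZZ.
Proof. by move: e; apply/allP; vm_compute. Qed.

Lemma config_inv_le l : l \in I11 ->
  (sumZ [seq Z.abs (config_inv e l) | e <- I11] <=? 20 * config_scaleJ)%ZZ.
Proof. by move: l; apply/allP; vm_compute. Qed.

Lemma config_slope_inv_le l : l \in I11 ->
  (sumZ [seq Z.abs ((if k == l then config_scale ^ 4 * config_scaleJ else 0) -
     sumZ [seq slope_sum config_system config_approx k e * config_inv e l | e <- I11])
     | k <- I11] * 4 <=? config_scale ^ 4 * config_scaleJ)%ZZ.
Proof.
(* Passed as an argument, the table is evaluated once and not again for every [l]. *)
pose table :=
  [seq [seq slope_sum config_system config_approx k e | e <- I11] | k <- I11].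
have : (fun t => all (fun l =>
  sumZ [seq Z.abs ((if k == l then config_scale ^ 4 * config_scaleJ else 0) -
     sumZ [seq nth 0 (nth [::] t k) e * config_inv e l | e <- I11]) | k <- I11] * 4
     <=? config_scale ^ 4 * config_scaleJ)%ZZ I11) table by vm_compute.
move=> /allP h ll; have {h} := h l ll.
by [].
Qed.

(** An exhaustive computation over all pairs takes the place of an argument by the symmetries of the
    configuration. *)
Lemma config_classes i j : i \in iota 0 58 -> j \in iota 0 58 -> i != j ->
  row_key (row_pairs i j) \in [seq row_key (config_system e) | e <- I11].
Proof.
move=> hi hj ij; move: j hj ij.
have : (fun keys => all (fun i => all (fun j =>
    (i != j) ==> (row_key (row_pairs i j) \in keys)) (iota 0 58)) (iota 0 58))
  [seq row_key (config_system e) | e <- I11].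
  by vm_compute.
by move=> /allP/(_ i hi)/allP h j /h/implyP.
Qed.

Lemma config_row i : i \in iota 0 58 ->
  (size (nth [::] codes i) == 56%N) && all small_code (nth [::] codes i).
Proof. by move: i; apply/allP; vm_compute. Qed.

Lemma config_system_small e : e \in I11 ->
  all (fun c => small_code c.1 && small_code c.2) (config_system e).
Proof. by move: e; apply/allP; vm_compute. Qed.

(** As [D] is nonzero, distinct indices give distinct points and the set has exactly [k]
    elements. *)
Lemma equilateral_sizeI (R : realType) (n k : nat) (p D : R) (x : 'I_k -> 'rV[R]_n) :
  p != 0 -> D != 0 ->
  (forall i j, i != j -> \sum_(r < n) `|x i 0 r - x j 0 r| `^ p = D) ->
  equilateral_sizes (@lp_norm R n p) k.
Proof.
move=> p0 D0 xD.
have xI : injective x.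
  move=> i j xij; apply/eqP; apply: contraT => ij; case/negP: D0.
  rewrite -(xD _ _ ij) xij big1// => r _.
  by rewrite subrr normr0 powR0.
exists [fset x i | i in 'I_k]%fset; last first.
  by rewrite card_imfset //= -?cardE ?card_ord.
exists (D `^ p^-1) => y z /imfsetP[/= i _ ->] /imfsetP[/= j _ ->] ij.
have ij' : i != j by apply: contra_notN ij => /eqP ->.
rewrite /lp_norm -(xD _ _ ij'); congr (_ `^ _); apply: eq_bigr => r _.
by rewrite !mxE.
Qed.

Lemma config_sizes (R : realType) (p : R) : `|p - 5| < 10 ^- 13 ->
  equilateral_sizes (@lp_norm R 56 p) 58.
Proof.
move=> p5.
have [x /rowP xE] := @system_zero R config_system config_approx config_inv
  config_scale config_scaleJ isT isT config_size config_diff_le config_residual_le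
  config_inv_le config_slope_inv_le p p5.
have sysE e : e \in iota 0 11 ->
    \sum_(c <- config_system e) pair_dist (var_val config_approx config_scale x) p c = 1.
  rewrite mem_iota => /= e11; have := xE (Ordinal e11); rewrite !mxE => /eqP.
  by rewrite subr_eq0 => /eqP.
pose pt (i : 'I_58) : 'rV[R]_56 :=
  \row_r code_val (var_val config_approx config_scale x) (nth 0%ZZ (nth [::] codes i) r).
have e13 : (10 ^- 13 : R) < 1 by rewrite invf_lt1 ?exprn_gt0// exprn_egt1// ltr1n.
apply: (@equilateral_sizeI _ _ _ _ 1 pt) => //.
  by rewrite lt0r_neq0//; move: p5; rewrite ltr_norml; lra.
move=> i j ij.
have mi : (i : nat) \in iota 0 58 by rewrite mem_iota; exact: ltn_ord.
have mj : (j : nat) \in iota 0 58 by rewrite mem_iota; exact: ltn_ord.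
have /andP[/eqP si /allP ci] := config_row mi.
have /andP[/eqP sj /allP cj] := config_row mj.
have /mapP[e e11 ek] := config_classes mi mj ij.
have sz : size (row_pairs i j) = 56 by rewrite size_zip si sj.
(* Equal keys transfer the value 1 from the representative to the pair [i], [j]. *)
rewrite -(sysE e e11) -(eq_row_key_sum _ _ _ _ ek) ?config_system_small//; last first.
  apply/allP => -[c d] cd /=.
  have hc : c \in unzip1 (row_pairs i j) := map_f fst cd.
  have hd : d \in unzip2 (row_pairs i j) := map_f snd cd.
  rewrite unzip1_zip ?si ?sj// in hc; rewrite unzip2_zip ?si ?sj// in hd.
  by rewrite ci ?cj.
rewrite (big_nth (0, 0)%ZZ) big_mkord sz; apply: eq_bigr => r _.
by rewrite /pair_dist nth_zip ?si ?sj// !mxE.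
Qed.

Theorem corollary2 (R : realType) :
  (exists2 eps : R, 0 < eps &
     forall p : R, `|p - 5| < eps -> (58 <= e_lp p 56)%N) /\
  (forall p0 : R,
     p0 = inf [set p : R | 2 < p /\
            exists n : nat, (0 < n)%N /\ (n + 1 < e_lp p n)%N] ->
     4 <= p0 < 5).
Proof.
have e0 : 0 < (10 ^- 13 : R) by rewrite invr_gt0 exprn_gt0.
have e1 : (10 ^- 13 : R) < 1 by rewrite invf_lt1 ?exprn_gt0// exprn_egt1// ltr1n.
have near5 (p : R) : `|p - 5| < 10 ^- 13 -> (58 <= e_lp p 56)%N.
  move=> p5; apply: le_e_lp; last exact: config_sizes.
  by move: p5; rewrite ltr_norml; lra.
split; first by exists (10 ^- 13).
move=> _ ->; set P := (X in inf X).
(* A member of the set strictly below 5 makes the infimum less than 5. *)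
pose q : R := 5 - 10 ^- 13 / 2.
have Pq : P q.
  split; first by rewrite /q; lra.
  exists 56%N; split=> //; apply: (@leq_trans 58) => //; apply: near5.
  by rewrite /q ltr_norml; lra.
have lbP : lbound P 4.
  move=> p [p2 [n [_ np]]]; rewrite leNgt; apply/negP => p4.
  have [m nm /equilateral_size_le_succ] := size_lt_e_lp np.
  by rewrite p2 p4 leqNgt -addn1 nm => /(_ isT).
rewrite lb_le_inf//=; last by exists q.
apply: le_lt_trans (_ : q < 5); last by rewrite /q; lra.
by apply: ge_inf => //; exists 4.
Qed.
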